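(* Let $\Delta$ be a $(d-1)$-dimensional complete $p$-partite matroid on $[n]$, with parallel classes (partition sets of the $1$-skeleton) $A_1,\ldots,A_p$, and let $a_i=|A_i|$ for $i=1,\ldots,p$. Let $\Gamma$ be the pure order ideal of monomials in the variables $y_1,\ldots,y_d$ whose set of maximal monomials is $$\Big\{\, y_1^{(\sum_{i=l_0}^{l_1-1}a_i)-1}\,y_2^{(\sum_{i=l_1}^{l_2-1}a_i)-1}\cdots y_d^{(\sum_{i=l_{d-1}}^{p}a_i)-1} \ :\ 1=l_0<l_1<l_2<\cdots<l_{d-1}\le p \,\Big\}.$$ Then $h^\Delta=f(\Gamma)$, where $h^\Delta$ is the $h$-vector of the algebra $S/J(\Delta)$.
   Context: A matroid on $[n]=\{1,\ldots,n\}$ is identified with its simplicial complex $\Delta$ of independent sets (a simplicial complex such that for $F,G\in\Delta$ with $|F|<|G|$ there is $i\in G\setminus F$ with $F\cup\{i\}\in\Delta$); it is assumed throughout that every $v\in[n]$ is a vertex of $\Delta$. The dimension of $\Delta$ is $\max\{|F|-1 : F\in\Delta\}$; $\mathcal F(\Delta)$ is the set of facets. The $1$-skeleton of $\Delta$, viewed as a graph on $[n]$ whose edges are the two-element faces, is a complete $p$-partite graph for some $p$, i.e. $[n]=A_1\cup\cdots\cup A_p$ is a partition into nonempty sets such that $\{v,w\}$ is an edge iff $v,w$ lie in different $A_i$; the sets $A_i$ are called parallel classes. A $(d-1)$-dimensional matroid $\Delta$ with parallel classes $A_1,\ldots,A_p$ is a complete $p$-partite matroid if for every subset $\{i_1,\ldots,i_d\}\subseteq\{1,\ldots,p\}$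 of $d$ indices and every choice $v_{i_j}\in A_{i_j}$ one has $\{v_{i_1},\ldots,v_{i_d}\}\in\Delta$ (for a matroid, this does not depend on the choice of the vertices in the classes). $\Bbbk$ is a field, $S=\Bbbk[x_1,\ldots,x_n]$, and $J(\Delta)=\bigcap_{F\in\mathcal F(\Delta)}(x_i : i\in F)$ is the cover ideal. The $h$-vector $h^\Delta$ of $S/J(\Delta)$ is the coefficient vector of the polynomial $h(t)$ with Hilbert series of $S/J(\Delta)$ equal to $h(t)/(1-t)^{\dim S/J(\Delta)}$. An order ideal is a finite set of monomials closed under taking divisors; it is pure if its maximal (with respect to divisibility) monomials all have the same degree; its $f$-vector $f(\Gamma)=(f_0,\ldots,f_s)$ counts the monomials of $\Gamma$ by degree. *)

(* Defs.v *)
From HB Require Import structures.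
From mathcomp Require Import all_boot all_order all_algebra.
From mathcomp Require Import finmap.
From mathcomp.multinomials Require Import mpoly.

Set Implicit Arguments.
Unset Strict Implicit.
Unset Printing Implicit Defensive.

Import GRing.Theory.
Local Open Scope ring_scope.

(* The ground set {1, ..., n} is represented by 'I_n = {0, ..., n-1}, and the
   index set {1, ..., p} of the parallel classes by 'I_p. *)

Section Complexes.
Variable n : nat.
Implicit Types (Delta : {set {set 'I_n}}) (F G : {set 'I_n}).

Definition simplicial_complex Delta : Prop :=
  set0 \in Delta /\
  forall F G, G \in Delta -> F \subset G -> F \in Delta.

Definition matroid Delta : Prop :=
  simplicial_complex Delta /\
  forall F G, F \in Delta -> G \in Delta -> (#|F| < #|G|)%N ->
    exists2 i, i \in G :\: F & i |: F \in Delta.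

Definition all_vertices Delta : Prop := forall v : 'I_n, [set v] \in Delta.

Definition dimension Delta : int := (\max_(F in Delta) #|F|)%N%:Z - 1.

Definition facets Delta : {set {set 'I_n}} :=
  [set F in Delta | [forall G in Delta, (F \subset G) ==> (F == G)]].

Definition skeleton_edge Delta (v w : 'I_n) : bool :=
  (v != w) && ([set v; w] \in Delta).

Definition parallel_classes Delta (p : nat) (A : 'I_p -> {set 'I_n}) : Prop :=
  [/\ forall i, A i != set0,
      forall i j, i != j -> [disjoint A i & A j],
      \bigcup_i A i = [set: 'I_n] &
      forall i j v w, v \in A i -> w \in A j ->
        skeleton_edge Delta v w = (i != j)].

Definition complete_partite_matroid Delta (d p : nat)
    (A : 'I_p -> {set 'I_n}) : Prop :=
  [/\ matroid Delta, all_vertices Delta, dimension Delta = d%:Z - 1,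
      parallel_classes Delta A &
      forall (I : {set 'I_p}) (v : 'I_p -> 'I_n),
        #|I| = d -> (forall i, i \in I -> v i \in A i) ->
        [set v i | i in I] \in Delta].

End Complexes.

Section Algebra.
Variables (k : fieldType) (n : nat).
Local Notation S := {mpoly k[n]}.
Implicit Types (I P Q : S -> Prop).

Definition variable_ideal (F : {set 'I_n}) : S -> Prop :=
  fun f => exists q : 'I_n -> S, f = \sum_(i in F) q i * 'X_i.

Definition cover_ideal (Delta : {set {set 'I_n}}) : S -> Prop :=
  fun f => forall F, F \in facets Delta -> variable_ideal F f.

Definition is_ideal I : Prop :=
  [/\ I 0, forall f g, I f -> I g -> I (f + g) &
      forall f g, I g -> I (f * g)].

Definition is_prime_ideal P : Prop :=
  [/\ is_ideal P, ~ P 1 & forall f g, P (f * g) -> P f \/ P g].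

Definition ideal_le I Q : Prop := forall f, I f -> Q f.

Definition ideal_lt I Q : Prop :=
  ideal_le I Q /\ exists2 f, Q f & ~ I f.

(* Prime ideals of S / I are identified with the prime ideals of S that
   contain I. *)
Definition prime_chain I (r : nat) (P : nat -> S -> Prop) : Prop :=
  (forall i, (i <= r)%N -> is_prime_ideal (P i) /\ ideal_le I (P i)) /\
  (forall i, (i < r)%N -> ideal_lt (P i) (P i.+1)).

Definition krull_dim_quotient I (D : nat) : Prop :=
  (exists P : nat -> S -> Prop, prime_chain I D P) /\
  forall r (P : nat -> S -> Prop), prime_chain I r P -> (r <= D)%N.

(* dim_k (S / I)_m = N, for a homogeneous ideal I: the classes of b_0, ...,
   b_(N-1) form a basis of S_m modulo I. *)
Definition quotient_component_dim I (m N : nat) : Prop :=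
  exists b : 'I_N -> S,
    [/\ forall i, b i \is m.-homog,
        forall f, f \is m.-homog ->
          exists c : 'I_N -> k, I (f - \sum_i c i *: b i) &
        forall c : 'I_N -> k, I (\sum_i c i *: b i) -> forall i, c i = 0].

Definition hilbert_function I (H : nat -> nat) : Prop :=
  forall m, quotient_component_dim I m (H m).

(* With D = dim S / I, the polynomial h(t) satisfies
   (1 - t)^D * (\sum_m H(m) t^m) = h(t) as formal power series; the identity
   is written coefficient by coefficient. *)
Definition h_polynomial I (h : {poly int}) : Prop :=
  exists (D : nat) (H : nat -> nat),
    [/\ krull_dim_quotient I D, hilbert_function I H &
        forall m, \sum_(j < m.+1) ((1 - 'X) ^+ D)`_j * (H (m - j)%N)%:Z = h`_m].

Definition h_vector I (v : seq int) : Prop :=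
  exists2 h : {poly int}, h_polynomial I h & v = h :> seq int.

End Algebra.

Arguments cover_ideal k {n} Delta _.

Section OrderIdeals.
Variable d : nat.
Implicit Types (Gamma : {fset 'X_{1..d}}) (u w : 'X_{1..d}).

(* (w <= u)%MM is divisibility of monomials. *)
Definition order_ideal Gamma : Prop :=
  forall u w, u \in Gamma -> (w <= u)%MM -> w \in Gamma.

Definition maximal_monomial Gamma u : Prop :=
  u \in Gamma /\ forall w, w \in Gamma -> (u <= w)%MM -> w = u.

Definition pure Gamma : Prop :=
  forall u w, maximal_monomial Gamma u -> maximal_monomial Gamma w ->
    mdeg u = mdeg w.

Definition f_vector Gamma : seq nat :=
  mkseq (fun j => #|` [fset u in Gamma | mdeg u == j]%fset|)
        (\max_(u <- enum_fset Gamma) mdeg u).+1.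

(* With classes numbered from 0, l j stands for l_j - 1, and l d = p is added
   to close the last block, so that l_(d-1) <= p becomes l (d-1) < l d. *)
Definition block_monomial (p : nat) (a : 'I_p -> nat) u : Prop :=
  exists l : nat -> nat,
    [/\ l 0%N = 0%N, l d = p, forall j, (j < d)%N -> (l j < l j.+1)%N &
        u = [multinom ((\sum_(i < p | l j <= i < l j.+1) a i) - 1)%N | j < d]].

End OrderIdeals.

(* Main.v *)
Require Import Defs.
From mathcomp Require Import all_boot all_order all_algebra.
From mathcomp Require Import finmap.
From mathcomp.multinomials Require Import mpoly.
From mathcomp Require Import ring.
From Stdlib Require Import ClassicalEpsilon.

(** A monomial lies outside J(Delta) iff its support U leaves at least d of the
    classes A_i incomplete. Summing over U, (1 - t)^n times the Hilbert series is
    the sum of t^|U| (1 - t)^(n - |U|) over these U. Read t as a probability: if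
    every vertex is put into U independently with probability t, this is the
    probability that at least d of the events "A_i is not contained in U" occur,
    and these are independent of probability 1 - t^(a_i). Conditioning on the
    first class gives the recursion
      E(a :: s, d + 1) = (1 - t^a) E(s, d) + t^a E(s, d + 1),
    so E(s, d) = (1 - t)^d F(s, d) with
      F(a :: s, d + 1) = (1 + t + ... + t^(a - 1)) F(s, d) + t^a F(s, d + 1).
    The latter recursion also counts Gamma: filling the blocks greedily, a
    monomial with y_1-exponent b closes its first block at the first class if
    b < a, and otherwise b - a remains to be filled by the later classes.

    The dimension of S/J(Delta) is n - d. A prime containing J(Delta) contains the
    ideal P_F of some facet F. A count of monomials shows that any n - d + 1
    polynomials are algebraically dependent modulo P_F, and a strict chain of
    primes of length n - d + 1 above P_F is incompatible with such a relation:
    its lowest terms can be cancelled one prime at a time. *)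

Set Implicit Arguments.
Unset Strict Implicit.
Unset Printing Implicit Defensive.

Import GRing.Theory.
Local Open Scope ring_scope.

(** * Ideals generated by variables *)

Section VariableIdeals.
Variables (k : fieldType) (n : nat).
Local Notation S := {mpoly k[n]}.
Implicit Types (F G : {set 'I_n}) (f g : S) (m : 'X_{1..n}).

Definition msupport m : {set 'I_n} := [set i | m i != 0%N].

Lemma ideal_sum (I : S -> Prop) (T : eqType) (r : seq T) (E : T -> S) :
  is_ideal I -> (forall x, x \in r -> I (E x)) -> I (\sum_(x <- r) E x).
Proof.
case=> I0 ID _; elim: r => [|x r IHr] HE; first by rewrite big_nil.
rewrite big_cons; apply: ID; first by apply: HE; rewrite mem_head.
by apply: IHr => y yr; apply: HE; rewrite inE yr orbT.
Qed.

Lemma ideal_scale (I : S -> Prop) (c : k) f : is_ideal I -> I f -> I (c *: f).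
Proof. by case=> _ _ IM If; rewrite -mul_mpolyC; apply: IM. Qed.

Lemma variable_ideal_ideal F : is_ideal (@variable_ideal k n F).
Proof.
split.
- by exists (fun=> 0); rewrite big1 // => i _; rewrite mul0r.
- move=> f g [q ->] [r ->]; exists (fun i => q i + r i).
  by rewrite -big_split; apply: eq_bigr => i _; rewrite mulrDl.
- move=> f g [q ->]; exists (fun i => f * q i).
  by rewrite mulr_sumr; apply: eq_bigr => i _; rewrite mulrA.
Qed.

Lemma variable_ideal_var F i : i \in F -> variable_ideal F ('X_i : S).
Proof.
move=> iF; exists (fun j => (i == j)%:R).
rewrite (bigD1 i) //= eqxx mul1r big1 ?addr0 // => j /andP[_ /negPf].
by rewrite eq_sym => ->; rewrite mul0r.
Qed.

Lemma variable_ideal_sub F (I : S -> Prop) : is_ideal I ->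
  (forall i, i \in F -> I 'X_i) -> ideal_le (variable_ideal F) I.
Proof.
move=> II IX f [q ->]; rewrite -big_enum; apply: ideal_sum => // i.
by rewrite mem_enum => iF; case: II => _ _; apply; apply: IX.
Qed.

Lemma mpolyX_factor m i : m i != 0%N -> 'X_[m] = 'X_[m - U_(i)] * 'X_i :> S.
Proof.
move=> mi; rewrite -mpolyXD.
congr ('X_[_]); apply/mnmP => j; rewrite mnmDE mnmBE mnm1E.
by case: eqP => [<-|_]; rewrite ?addn0 ?subn0 ?subnK ?lt0n.
Qed.

(** Membership is decided term by term: a monomial lies in P_F exactly when some variable of F
    divides it. *)
Lemma variable_idealP F f :
  variable_ideal F f <->
  (forall m, m \in msupp f -> ~~ [disjoint F & msupport m]).
Proof.
split=> [[q ->] m /msupp_sum_le|Hf].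
  case/flattenP => s /mapP[i].
  rewrite mem_filter => /andP[iF _] -> /msuppM_le.
  case/allpairsP => -[m1 m2] /= [_]; rewrite msuppX mem_seq1 => /eqP-> ->.
  apply/pred0Pn; exists i; rewrite /= iF inE.
  by rewrite mnmDE mnm1E eqxx addn1.
rewrite (mpolyE f); apply: ideal_sum; first exact: variable_ideal_ideal.
move=> m /Hf /pred0Pn[i /= /andP[iF]]; rewrite inE => mi.
apply: ideal_scale; first exact: variable_ideal_ideal.
rewrite (mpolyX_factor mi); case: (variable_ideal_ideal F) => _ _; apply.
exact: variable_ideal_var.
Qed.

Definition kill_vars F : n.-tuple S := [tuple (if i \in F then 0 else 'X_i) | i < n].

Lemma kill_varsX F m : 'X_[m] \mPo kill_vars F =
  if [disjoint F & msupport m] then 'X_[m] else 0 :> S.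
Proof.
rewrite comp_mpolyX; case: ifPn => [dis|/pred0Pn[i /= /andP[iF]]].
  rewrite [RHS]mpolyXE_id; apply: eq_bigr => i _; rewrite tnth_mktuple.
  case: ifP => // iF; have := disjointFr dis iF.
  by rewrite inE => /negbFE/eqP->; rewrite !expr0.
rewrite inE => mi; rewrite (bigD1 i) //= tnth_mktuple iF expr0n (negPf mi).
by rewrite mul0r.
Qed.

(** This exhibits P_F as the kernel of an endomorphism of the domain S, whence its primality.
    Conversely, [f] minus its image retains only terms divisible by a variable of F. *)
Lemma variable_ideal_kill F f : variable_ideal F f <-> f \mPo kill_vars F = 0.
Proof.
split=> [[q ->]|H0].
  rewrite rmorph_sum big1 //= => i iF; rewrite rmorphM /=.
  by rewrite comp_mpolyXU -tnth_nth tnth_mktuple iF mulr0.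
rewrite -[f]subr0 -H0 {1 2}(mpolyE f) rmorph_sum -sumrB /=.
apply: ideal_sum; first exact: variable_ideal_ideal.
move=> m _; rewrite linearZ -scalerBr /=.
apply: ideal_scale; first exact: variable_ideal_ideal.
rewrite kill_varsX; apply/variable_idealP => m'.
case: ifPn => dis; first by rewrite subrr msupp0.
by rewrite subr0 msuppX mem_seq1 => /eqP ->.
Qed.

Lemma variable_ideal_prime F : is_prime_ideal (@variable_ideal k n F).
Proof.
split; first exact: variable_ideal_ideal.
  by move/variable_ideal_kill/eqP; rewrite rmorph1 oner_eq0.
move=> f g /variable_ideal_kill/eqP; rewrite rmorphM mulf_eq0.
by case/orP => /eqP ?; [left | right]; apply/variable_ideal_kill.
Qed.

Lemma variable_ideal_varE F i : variable_ideal F ('X_i : S) -> i \in F.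
Proof.
move/variable_idealP/(_ U_(i)%MM); rewrite msuppX mem_head => /(_ isT).
case/pred0Pn => j /= /andP[jF]; rewrite inE mnm1E.
by case: (i =P j) => [->|_].
Qed.

End VariableIdeals.

(** * Krull dimension *)

Fixpoint exponent_box (B M : nat) : seq (seq nat) :=
  if M is M'.+1 then [seq j :: s | j <- index_iota 0 B, s <- exponent_box B M']
  else [:: [::]].

Lemma size_exponent_box B M : size (exponent_box B M) = (B ^ M)%N.
Proof.
by elim: M => //= M IH; rewrite size_allpairs IH size_iota subn0 expnS.
Qed.

Lemma exponent_box_uniq B M : uniq (exponent_box B M).
Proof.
elim: M => //= M IH; rewrite allpairs_uniq ?iota_uniq //.
by move=> [i s] [j t] _ _ /= [-> ->].
Qed.

Lemma sumn_exponent_box B M s :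
  s \in exponent_box B M -> size s = M /\ (sumn s <= M * B)%N.
Proof.
elim: M s => [|M IH] s /=; first by rewrite mem_seq1 => /eqP ->.
case/allpairsP => -[j t] /= [jB /IH[st lt] ->] /=.
by rewrite st mulSn leq_add // ltnW //; move: jB; rewrite mem_index_iota.
Qed.

Lemma linear_dependence (k : fieldType) (T : finType) (r : nat)
    (u : 'I_r -> T -> k) : (#|T| < r)%N ->
  exists v : 'I_r -> k, (exists i, v i != 0) /\
    forall t, \sum_i v i * u i t = 0.
Proof.
move=> ltTr; pose A := \matrix_(i < r, j < #|T|) u i (enum_val j).
have : kermx A != 0.
  rewrite -mxrank_eq0 mxrank_ker -lt0n subn_gt0.
  exact: leq_ltn_trans (rank_leq_col A) ltTr.
case/rowV0Pn => v /sub_kermxP vA v0; exists (fun i => v 0 i); split.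
  by case/rV0Pn: v0 => i; exists i.
move=> t; move/rowP/(_ (enum_rank t)): vA; rewrite !mxE => {2}<-.
by apply: eq_bigr => i _; rewrite mxE enum_rankK.
Qed.

Section Primes.
Variables (k : fieldType) (n : nat).
Local Notation S := {mpoly k[n]}.
Implicit Types (F G : {set 'I_n}) (f g : S) (m : 'X_{1..n}).

Fixpoint monomial_in (x : nat -> S) (s : seq nat) : S :=
  if s is j :: s' then x 0%N ^+ j * monomial_in (fun i => x i.+1) s' else 1.

Lemma prime_ideal_cancelX (P : S -> Prop) f g j :
  is_prime_ideal P -> ~ P f -> P (f ^+ j * g) -> P g.
Proof.
case=> _ _ PM nPf; elim: j => [|j IH]; first by rewrite mul1r.
by rewrite exprS -mulrA => /PM[].
Qed.

(* The lowest power of x_0 can be cancelled modulo P_0, after which reduction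
   modulo P_1 removes all terms that still involve x_0. *)
Lemma chain_independent B M (P : nat -> S -> Prop) (x : nat -> S)
    (c : seq nat -> k) :
  (forall i, (i <= M)%N -> is_prime_ideal (P i)) ->
  (forall i, (i < M)%N -> ideal_le (P i) (P i.+1)) ->
  (forall i, (i < M)%N -> P i.+1 (x i) /\ ~ P i (x i)) ->
  P 0%N (\sum_(s <- exponent_box B M) c s *: monomial_in x s) ->
  forall s, s \in exponent_box B M -> c s = 0.
Proof.
elim: M P x c => [|M IH] P x c Pprime Ple Px.
  rewrite /= big_seq1 /= => P0 s; rewrite mem_seq1 => /eqP ->.
  case: (Pprime 0%N) => // II P1 _; apply/eqP/negPn/negP => c0.
  apply: P1; rewrite -[1](scalerK c0).
  exact: ideal_scale.
rewrite /= big_allpairs_dep /=.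
pose y i := x i.+1.
pose G j := \sum_(s <- exponent_box B M) c (j :: s) *: monomial_in y s.
have -> : \sum_(j <- index_iota 0 B) \sum_(s <- exponent_box B M)
    c (j :: s) *: (x 0%N ^+ j * monomial_in y s) =
    \sum_(0 <= j < B) x 0%N ^+ j * G j.
  apply: eq_bigr => j _; rewrite mulr_sumr; apply: eq_bigr => s _.
  by rewrite scalerAr.
move=> P0.
suff H j : (j < B)%N -> forall s, s \in exponent_box B M -> c (j :: s) = 0.
  move=> s /allpairsP[[j t] /= [jB tB ->]]; apply: H => //.
  by rewrite mem_index_iota in jB.
have [x0P1 x0P0] := Px 0%N isT.
have [II1 _ _] := Pprime 1%N isT.
elim/ltn_ind: j => j IHj jB.
apply: (IH (fun i => P i.+1) y) => [i|i|i|];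
  [exact: (Pprime i.+1) | exact: (Ple i.+1) | exact: (Px i.+1) |].
rewrite -/(G j).
pose R := \sum_(j.+1 <= i < B) x 0%N ^+ (i - j.+1) * G i.
have E : \sum_(0 <= j < B) x 0%N ^+ j * G j = x 0%N ^+ j * (G j + x 0%N * R).
  rewrite (big_cat_nat (leq0n j) (ltnW jB)) /= big_nat big1 ?add0r; last first.
    move=> i /andP[_ ij]; rewrite /G big_seq big1 ?mulr0 // => s sB.
    by rewrite (IHj i) ?scale0r // (ltn_trans ij).
  rewrite big_ltn // mulrDr; congr (_ + _).
  rewrite mulrA -exprSr /R mulr_sumr big_nat [RHS]big_nat.
  by apply: eq_bigr => i /andP[ji _]; rewrite mulrA -exprD subnKC.
have P1 : P 1%N (G j + x 0%N * R).
  apply: Ple => //; apply: (prime_ideal_cancelX (Pprime 0%N isT) x0P0 (j := j)).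
  by rewrite -E.
case: II1 => _ ID IM.
rewrite -[G j](addrK (x 0%N * R)) -mulN1r; apply: ID => //; apply: (IM).
by rewrite mulrC; apply: IM.
Qed.

Lemma monomial_in_mdeg (x : nat -> S) (s : seq nat) D :
  (forall i, (i < size s)%N -> forall m, m \in msupp (x i) -> mdeg m <= D)%N ->
  (forall m, m \in msupp (monomial_in x s) -> mdeg m <= sumn s * D)%N.
Proof.
elim: s x => [|j s IH] x Hx m /=.
  by rewrite msupp1 mem_seq1 => /eqP ->; rewrite mdeg0.
have Hj i m' : (m' \in msupp (x 0%N ^+ i) -> mdeg m' <= i * D)%N.
  elim: i m' => [|i IHi] m'.
    by rewrite expr0 msupp1 mem_seq1 => /eqP ->; rewrite mdeg0.
  rewrite exprS => /msuppM_le/allpairsP[[m1 m2] /= [H1 H2 ->]].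
  by rewrite mdegD mulSn leq_add ?IHi ?(Hx 0%N).
case/msuppM_le/allpairsP => -[m1 m2] /= [H1 H2 ->].
rewrite mdegD mulnDl; apply: leq_add; first exact: Hj.
by apply: (IH _ _ _ H2) => i; apply: (Hx i.+1).
Qed.

(* With exponents below B, N + 1 elements have B ^ (N + 1) products, which lie
   in a space of dimension O(B ^ N) modulo the ideal. *)
Lemma algebraic_dependence F (x : nat -> S) :
  exists B c, variable_ideal F
      (\sum_(s <- exponent_box B #|~: F|.+1) c s *: monomial_in x s) /\
    exists2 s, s \in exponent_box B #|~: F|.+1 & c s != 0.
Proof.
(* All products have degree at most E = (N+1)BD, and E + 1 <= BC for C = (N+1)D + 1. Hence at most
   (BC)^N monomials outside F occur, fewer than B^(N+1) because B > C^N. *)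
set N := #|~: F|; pose D := (\max_(i < N.+1) msize (x i))%N.
pose C := (N.+1 * D + 1)%N; pose B := (C ^ N).+1.
pose E := (N.+1 * B * D)%N; pose box := exponent_box B N.+1.
pose T := {g : {ffun 'I_n -> 'I_E.+1} | g \in pffun_on ord0 (~: F) predT}.
pose mnm (t : T) : 'X_{1..n} := [multinom val (val t i) | i < n].
have ltT : (#|{: T}| < size box)%N.
  rewrite card_sig card_pffun_on size_exponent_box card_ord -/N expnS.
  have le1 : (E.+1 <= B * C)%N.
    by rewrite /E /C mulnDr muln1 mulnAC [(_ * B)%N]mulnC -addn1 leq_add2l.
  apply: (@leq_ltn_trans ((B * C) ^ N)).
    by case: (posnP N) => [->|N_gt0]; rewrite ?expn0 ?leq_exp2r.
  by rewrite expnMn mulnC ltn_pmul2r ?expn_gt0 // /B.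
pose u (i : 'I_(size box)) t := (monomial_in x (nth [::] box i))@_(mnm t).
have [v [[i0 vi0] Hv]] := linear_dependence u ltT.
(* The box has no repetitions, so the position of [s] determines its coefficient; the default 0 is
   used only off the box. *)
pose c s := if insub (index s box) is Some i then v i else 0.
have cE (i : 'I_(size box)) : c (nth [::] box i) = v i.
  by rewrite /c index_uniq ?exponent_box_uniq // valK.
exists B, c; split; last first.
  by exists (nth [::] box i0); rewrite ?mem_nth ?cE.
apply/variable_idealP => m mS; apply/negP => dis.
have mE : (mdeg m <= E)%N.
  move/msupp_sum_le/flattenP: mS => [ms /mapP[s]]; rewrite filter_predT => sB ->.
  move/msuppZ_le/(@monomial_in_mdeg _ _ D) => le_m.
  have [sz le_s] := sumn_exponent_box sB.
  apply: leq_trans (le_m _) _; last by rewrite leq_mul2r le_s orbT.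
  move=> i; rewrite sz => iN m' /msize_mdeg_lt/ltnW/leq_trans; apply.
  exact: (leq_bigmax (Ordinal iN)).
pose g := [ffun i => inord (m i) : 'I_E.+1].
have gE i : g i = m i :> nat.
  rewrite ffunE inordK // ltnS; apply: leq_trans mE.
  by rewrite mdegE (bigD1 i) //= leq_addr.
have gF : g \in pffun_on ord0 (~: F) predT.
  apply/pffun_onP; split=> // ; apply/subsetP => i; rewrite !inE => gi.
  apply/negP => iF; move: (disjointFr dis iF); rewrite inE => /negbFE/eqP mi.
  by case/eqP: gi; apply: val_inj; rewrite /= gE.
have mnm_g : mnm (Sub g gF) = m by apply/mnmP => i; rewrite mnmE SubK -gE.
move: mS; rewrite mcoeff_msupp => /eqP; apply.
rewrite -{}[RHS](Hv (Sub g gF)) raddf_sum /= -/box (big_nth [::]) big_mkord.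
by apply: eq_bigr => i _; rewrite mcoeffZ cE /u mnm_g.
Qed.

Lemma prime_chain_bound F r (P : nat -> S -> Prop) :
  prime_chain (variable_ideal F) r P -> (r <= #|~: F|)%N.
Proof.
case=> Pprime Plt; rewrite leqNgt; apply/negP => ltr.
(* The bound i < r sits inside the existential so that choice yields a total sequence x_i in P_(i+1)
   outside P_i. *)
have H i : exists f, (i < r)%N -> P i.+1 f /\ ~ P i f.
  case: (ltnP i r) => [ir|]; last by exists 0.
  by case: (Plt i ir) => _ [f]; exists f.
pose x i := proj1_sig (constructive_indefinite_description _ (H i)).
have xP i : (i < r)%N -> P i.+1 (x i) /\ ~ P i (x i).
  exact: proj2_sig (constructive_indefinite_description _ (H i)).
have [B [c [Fc [s sB]]]] := algebraic_dependence F x.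
case/eqP; apply: (@chain_independent B _ P x c) sB => [i iN|i iN|i iN|].
- by case: (Pprime i (leq_trans iN ltr)).
- by case: (Plt i (leq_trans iN ltr)).
- exact: xP (leq_trans iN ltr).
- by case: (Pprime 0%N isT) => _; apply.
Qed.

Lemma prime_chain_variables F :
  exists P : nat -> S -> Prop, prime_chain (variable_ideal F) #|~: F| P.
Proof.
(* The chain adjoins the variables outside F one at a time. *)
pose e := enum (~: F); pose G i := F :|: [set j in take i e].
exists (fun i => variable_ideal (G i)); split=> i.
  move=> _; split; first exact: variable_ideal_prime.
  apply: variable_ideal_sub; first exact: variable_ideal_ideal.
  by move=> j jF; apply: variable_ideal_var; rewrite inE jF.
rewrite cardE -/e => ie; have eU : uniq e := enum_uniq _.
case De : e ie => [//|v0 e']; rewrite -De => ie.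
split.
  apply: variable_ideal_sub; first exact: variable_ideal_ideal.
  move=> j; rewrite !inE => jG; apply: variable_ideal_var; rewrite !inE.
  by rewrite (take_nth v0 ie) mem_rcons inE; case/orP: jG => ->; rewrite ?orbT.
exists 'X_(nth v0 e i).
  by apply: variable_ideal_var; rewrite !inE (take_nth v0 ie) mem_rcons mem_head orbT.
move/variable_ideal_varE; rewrite !inE.
have: nth v0 e i \in e by rewrite mem_nth.
rewrite mem_enum inE => /negPf -> /=.
move: eU; rewrite -{1}(cat_take_drop i e) cat_uniq => /and3P[_ /hasPn + _].
move/(_ (nth v0 e i)); rewrite (drop_nth v0 ie) mem_head => /(_ isT).
by move=> /negPf ->.
Qed.

End Primes.

(** * The h-polynomial and the greedy enumeration *)

(* [h_sum s d] is the sum over d-subsets I of the product of the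
   [1 + X + ... + X^(a_i - 1)] for i in I and of the X^(a_i) for the
   i < max I outside I, where s = (a_1, ..., a_p). *)
Fixpoint h_sum (s : seq nat) (d : nat) : {poly int} :=
  match d, s with
  | 0%N, _ => 1
  | _.+1, [::] => 0
  | d'.+1, a :: s' =>
      (\sum_(b < a) 'X^b) * h_sum s' d' + 'X^a * h_sum s' d
  end.

(* The probability that at least d of independent events with probabilities
   1 - X^(a_i) occur. *)
Fixpoint at_least (s : seq nat) (d : nat) : {poly int} :=
  match d, s with
  | 0%N, _ => 1
  | _.+1, [::] => 0
  | d'.+1, a :: s' => (1 - 'X^a) * at_least s' d' + 'X^a * at_least s' d
  end.

Lemma at_leastE s d : at_least s d = (1 - 'X) ^+ d * h_sum s d.
Proof.
elim: s d => [|a s IH] [|d] /=; rewrite ?expr0 ?mul1r ?mulr0 //.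
rewrite !IH -opprB subrX1 -mulNr opprB exprS.
under eq_bigr do []; set g := \sum_(b < a) 'X^b.
by ring.
Qed.

(** In the second branch [bs] is nonempty, so the default of [head] never matters. Adding [a] makes
    its first entry at least [a], which keeps the two branches disjoint. *)
Fixpoint greedy (s : seq nat) (d : nat) : seq (seq nat) :=
  match d, s with
  | 0%N, _ => [:: [::]]
  | _.+1, [::] => [::]
  | d'.+1, a :: s' =>
      [seq b :: bs | b <- iota 0 a, bs <- greedy s' d'] ++
      [seq (a + head 0%N bs)%N :: behead bs | bs <- greedy s' d]
  end.

Lemma greedy_size s d bs : bs \in greedy s d -> size bs = d.
Proof.
elim: s d bs => [|a s IH] [|d] bs //=; rewrite ?mem_seq1; try by move/eqP ->.
rewrite mem_cat => /orP[/allpairsP[[b t] /= [_ /IH <- ->]] //|].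
by case/mapP => t /IH + ->; case: t => //= b t [->].
Qed.

Lemma greedy_uniq s d : uniq (greedy s d).
Proof.
elim: s d => [|a s IH] [|d] //=; rewrite cat_uniq; apply/and3P; split.
- by apply: allpairs_uniq; rewrite ?iota_uniq // => -[b t] [c u] _ _ /= [-> ->].
- apply/hasPn => _ /mapP[t _ ->]; apply/negP => /allpairsP[[b u] /= [ba _ [E _]]].
  by move: ba; rewrite -E mem_iota add0n ltnNge leq_addr.
rewrite map_inj_in_uniq // => t u /greedy_size + /greedy_size.
by case: t u => [|b t] [|c u] //= _ _ [/addnI -> ->].
Qed.

Lemma h_sumE s d : \sum_(bs <- greedy s d) 'X^(sumn bs) = h_sum s d.
Proof.
elim: s d => [|a s IH] [|d] /=; rewrite ?big_nil ?big_seq1 //.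
rewrite big_cat big_allpairs_dep big_map /= -!IH mulr_suml; congr (_ + _).
  rewrite -[X in iota _ X]subn0 -/(index_iota 0 a) big_mkord; apply: eq_bigr => b _.
  by rewrite mulr_sumr; apply: eq_bigr => t _; rewrite /= exprD.
rewrite mulr_sumr big_seq [RHS]big_seq; apply: eq_bigr => t /greedy_size.
by case: t => //= b t _; rewrite -addnA exprD.
Qed.

(** The cuts need neither start at 0 nor end at [size s]. This freedom carries the induction: once a
    block is closed at the first class, the remaining cuts may start later. *)
Lemma greedyP s bs d :
  bs \in greedy s d <-> size bs = d /\
    exists l : nat -> nat, (l d <= size s)%N /\
      forall j, (j < d)%N ->
        (nth 0 bs j < \sum_(l j <= i < l j.+1) nth 0 s i)%N.
Proof.
split.
  move=> bsG; split; first exact: greedy_size bsG.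
  elim: s d bs bsG => [|a s IH] [|d] bs //=; try by exists (fun=> 0%N).
  rewrite mem_cat => /orP[/allpairsP[[b t] /= [ba tG ->]]|].
    have [l [ld Hl]] := IH _ _ tG.
    exists (fun j => if j is j'.+1 then (l j').+1 else 0%N); split=> // -[|j] jd.
      rewrite /= big_ltn // (leq_trans _ (leq_addr _ _)) //.
      by move: ba; rewrite mem_iota.
    by rewrite /= big_add1 /=; apply: Hl.
  case/mapP => t tG ->; have [l [ld Hl]] := IH _ _ tG.
  have := greedy_size tG; case: t tG Hl => // b t tG Hl [st].
  (* The first block is extended down to the first class, which can only enlarge its sum. *)
  exists (fun j => if j is j'.+1 then (l j).+1 else 0%N); split=> // -[|j] jd.
    rewrite /= big_ltn // ltn_add2l big_add1 /=.
    apply: leq_trans (Hl 0%N isT) _.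
    case: (leqP (l 0%N) (l 1%N)) => l01; last by rewrite big_geq // ltnW.
    by rewrite [leqRHS](big_cat_nat (leq0n (l 0%N))) //= leq_addl.
  by rewrite /= big_add1 /=; apply: (Hl j.+1).
case=> sz [l [ld Hl]].
elim: s d bs l sz ld Hl => [|a s IH] [|d] [|b bs] l //= [sz] ld Hl.
  by move: (Hl d (leqnn _)); rewrite big_geq // (leq_trans ld).
have l01 : (l 0%N < l 1%N)%N.
  by rewrite ltnNge; apply/negP => ?; have := Hl 0%N isT; rewrite big_geq.
have lS j : (j < d.+1)%N -> (l j < l j.+1)%N.
  by move=> jd; rewrite ltnNge; apply/negP => ?; have := Hl j jd; rewrite big_geq.
have l_gt0 j : (0 < j <= d.+1)%N -> (0 < l j)%N.
  by case: j => // j /= jd; apply: leq_ltn_trans (lS j jd).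
have shift j : (0 < j < d.+1)%N ->
    (\sum_((l j).-1 <= i < (l j.+1).-1) nth 0 s i =
     \sum_(l j <= i < l j.+1) nth 0 (a :: s) i)%N.
  case/andP=> j0 jd; rewrite -[in RHS](@prednK (l j)) ?l_gt0 ?j0 1?ltnW //.
  by rewrite big_add1.
have ld' : ((l d.+1).-1 <= size s)%N by rewrite -ltnS prednK ?l_gt0 ?leqnn.
(* If b < a, the first class alone serves as the first block. Otherwise [a] is taken off [b], and
   the block is stretched to start at the first remaining class. *)
rewrite mem_cat; case: (ltnP b a) => [ba|ab]; apply/orP; [left|right].
  apply/allpairsP; exists (b, bs); split=> //=; first by rewrite mem_iota.
  apply: (IH _ _ (fun j => (l j.+1).-1)) => // j jd.
  by rewrite shift ?(Hl j.+1).
apply/mapP; exists ((b - a)%N :: bs); last by rewrite /= subnKC.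
apply: (IH _ _ (fun j => if j is 0%N then 0%N else (l j).-1)) => //=; first by rewrite sz.
case=> [|j] jd; last by rewrite shift ?(Hl j.+1).
have : (b < \sum_(0 <= i < l 1%N) nth 0 (a :: s) i)%N.
  apply: leq_trans (Hl 0%N isT) _.
  by rewrite [leqRHS](big_cat_nat (leq0n (l 0%N)) (ltnW l01)) //= leq_addl.
rewrite big_ltn ?l_gt0 // -[in X in (_ < X)%N -> _](@prednK (l 1%N)) ?l_gt0 //.
by rewrite big_add1 /= ltn_subLR.
Qed.

(** * The order ideal *)

Definition class_sizes p (a : 'I_p -> nat) : seq nat := [seq a i | i <- enum 'I_p].

Lemma sum_class_sizes p (a : 'I_p -> nat) x y : (y <= p)%N ->
  (\sum_(x <= i < y) nth 0 (class_sizes a) i = \sum_(i < p | x <= i < y) a i)%N.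
Proof.
move=> yp; rewrite (big_nat_widen _ _ _ _ _ yp) (big_nat_widenl _ 0%N) //.
rewrite big_mkord; apply: eq_big => i; first by rewrite andbC.
by rewrite (nth_map i) ?size_enum_ord // nth_ord_enum.
Qed.

Lemma increasing_le_last (l : nat -> nat) d :
  (forall j, (j < d)%N -> (l j < l j.+1)%N) ->
  forall j, (j <= d)%N -> (l j <= l d)%N.
Proof.
move=> lS j jd; rewrite -(subKn jd); move: (d - j)%N (leq_subr j d) => i.
elim: i => [|i IH] id; first by rewrite subn0.
have lt_d : (d - i.+1 < d)%N by rewrite ltn_subrL (leq_ltn_trans _ id).
apply: leq_trans (IH (ltnW id)).
by move/ltnW: (lS _ lt_d); rewrite subnSK.
Qed.

Lemma bigmax_seq_attained (T : eqType) (r : seq T) (F : T -> nat) :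
  r != [::] -> exists2 x, x \in r & F x = (\max_(y <- r) F y)%N.
Proof.
elim: r => // x r IH _; rewrite big_cons.
case: (eqVneq r [::]) => [->|/IH[y yr Ey]].
  by exists x; rewrite ?mem_head // big_nil maxn0.
case: (leqP (F x) (\max_(y <- r) F y)) => _; last by exists x; rewrite ?mem_head.
by exists y; rewrite // inE yr orbT.
Qed.

Section Gamma.
Variables (d p : nat) (a : 'I_p -> nat) (Gamma : {fset 'X_{1..d}}).
Hypothesis a_gt0 : forall i, (0 < a i)%N.
(** For d = 0 a block monomial requires l 0 = 0 and l 0 = p, so it exists only if p = 0. *)
Hypothesis p0 : d = 0%N -> p = 0%N.
Hypothesis Gamma_ideal : order_ideal Gamma.
Hypothesis Gamma_max : forall u, maximal_monomial Gamma u <-> block_monomial a u.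

Definition exponents (u : 'X_{1..d}) : seq nat := [seq u i | i <- enum 'I_d].

Lemma size_exponents u : size (exponents u) = d.
Proof. by rewrite size_map size_enum_ord. Qed.

Lemma nth_exponents u (j : 'I_d) : nth 0%N (exponents u) j = u j.
Proof. by rewrite (nth_map j) ?size_enum_ord // nth_ord_enum. Qed.

Lemma exponents_inj : injective exponents.
Proof. by move=> u w E; apply/mnmP => j; rewrite -!nth_exponents E. Qed.

Lemma sumn_exponents u : sumn (exponents u) = mdeg u.
Proof. by rewrite mdegE sumnE big_map big_enum. Qed.

(** A multiple of [u] of largest degree in the finite set [Gamma] has no proper multiple there. *)
Lemma below_maximal u : u \in Gamma ->
  exists2 w, maximal_monomial Gamma w & (u <= w)%MM.
Proof.
move=> uG; pose t0 : Gamma := [` uG]%fset.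
have ut0 : (u <= val t0)%MM by exact: lepm_refl.
case: (@arg_maxnP _ t0 (fun w : Gamma => (u <= val w)%MM)
  (fun w => mdeg (val w)) ut0) => w uw Hw.
exists (val w) => //; split=> [|v vG wv]; first exact: valP.
have := Hw [` vG]%fset (lepm_trans uw wv) => /= le_vw.
have E : (v = val w + (v - val w))%MM.
  by apply/mnmP => i; rewrite mnmDE mnmBE subnKC //; apply/mnm_lepP.
move: le_vw; rewrite {1}E mdegD -[leqRHS]addn0 leq_add2l leqn0 mdeg_eq0 => /eqP v0.
by rewrite E v0 addm0.
Qed.

(** Exponents of a block monomial are block sums minus one, so its divisors are given by the strict
    bounds of [greedyP]. *)
Lemma mem_Gamma u : u \in Gamma <-> exponents u \in greedy (class_sizes a) d.
Proof.
have szs : size (class_sizes a) = p by rewrite size_map size_enum_ord.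
split=> [/below_maximal[w /Gamma_max[l [l0 ld lS Ew]] /mnm_lepP uw]|].
  have l_le j : (j <= d)%N -> (l j <= p)%N.
    by rewrite -ld; apply: increasing_le_last.
  apply/greedyP; split; first exact: size_exponents.
  exists l; split=> [|j jd]; first by rewrite ld szs.
  rewrite sum_class_sizes ?l_le // (nth_exponents u (Ordinal jd)).
  apply: leq_ltn_trans (uw _) _; rewrite Ew mnmE /= subn1 prednK //.
  have lp : (l j < p)%N by apply: leq_trans (lS j jd) (l_le _ jd).
  by rewrite (bigD1 (Ordinal lp)) /= ?leqnn ?lS // addn_gt0 a_gt0.
case/greedyP => _ [l []]; rewrite szs => ld Hl.
(* The cuts are stretched to run from 0 to p, which only enlarges the blocks. For d = 0 both end
   conditions fall on j = 0 and agree by [p0]. *)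
pose l' j := if j == d then p else if j == 0%N then 0%N else l j.
pose w := [multinom ((\sum_(i < p | l' j <= i < l' j.+1) a i) - 1)%N | j < d].
have lS j : (j < d)%N -> (l j < l j.+1)%N.
  by move=> jd; rewrite ltnNge; apply/negP => ?; have := Hl j jd; rewrite big_geq.
have lel j : (j < d)%N -> (l' j <= l j)%N.
  by move=> jd; rewrite /l' (ltn_eqF jd); case: eqP.
have gel j : (j < d)%N -> (l j.+1 <= l' j.+1)%N.
  by move=> jd; rewrite /l'; case: eqP => // ->.
have le_p j : (j < d)%N -> (l' j.+1 <= p)%N.
  move=> jd; rewrite /l'; case: eqP => // _.
  by apply: leq_trans ld; apply: increasing_le_last.
have /Gamma_max[wG _] : block_monomial a w.
  exists l'; split=> // [||j jd].
  - by rewrite /l'; case: eqP => // /esym/p0.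
  - by rewrite /l' eqxx.
  by apply: leq_trans (gel j jd); apply: leq_ltn_trans (lel j jd) (lS j jd).
apply: (Gamma_ideal wG); apply/mnm_lepP => j; rewrite mnmE.
have jd := ltn_ord j.
rewrite -sum_class_sizes ?le_p // -ltnS subn1.
have H : (u j < \sum_(l' j <= i < l' j.+1) nth 0 (class_sizes a) i)%N.
  rewrite -nth_exponents; apply: leq_trans (Hl j jd) _.
  rewrite [leqRHS](big_cat_nat (lel j jd)) /=; last first.
    by apply: leq_trans (gel j jd); apply: ltnW (lS j jd).
  rewrite [X in (_ <= _ + X)%N](big_cat_nat (ltnW (lS j jd)) (gel j jd)) /=.
  by rewrite addnCA leq_addr.
by rewrite prednK // (leq_trans _ H).
Qed.

Lemma Gamma_greedy :
  perm_eq [seq exponents u | u <- enum_fset Gamma] (greedy (class_sizes a) d).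
Proof.
apply: uniq_perm; last first.
- move=> bs; apply/mapP/idP => [[u uG ->]|bsG]; first exact/mem_Gamma.
  have E : bs = exponents [multinom nth 0%N bs i | i < d].
    apply: (@eq_from_nth _ 0%N) => [|j].
      by rewrite size_exponents (greedy_size bsG).
    rewrite (greedy_size bsG) => jd.
    by rewrite (nth_exponents _ (Ordinal jd)) mnmE.
  by exists [multinom nth 0%N bs i | i < d] => //; apply/mem_Gamma; rewrite -E.
- exact: greedy_uniq.
by rewrite map_inj_uniq ?fset_uniq //; apply: exponents_inj.
Qed.

(** Nonemptiness makes the last entry of the f-vector nonzero, as a polynomial's coefficient
    sequence demands. For empty [Gamma] the f-vector would be [[:: 0]], whereas the zero polynomial
    is [[::]]. *)
Lemma f_vectorE : greedy (class_sizes a) d != [::] ->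
  map Posz (f_vector Gamma) = h_sum (class_sizes a) d :> seq int.
Proof.
move=> gN0; pose N j := #|` [fset u in Gamma | mdeg u == j]%fset|.
have Ncount j : N j = count (fun u => mdeg u == j) (enum_fset Gamma).
  rewrite -size_filter; apply/perm_size/uniq_perm; first exact: fset_uniq.
    exact/filter_uniq/fset_uniq.
  by move=> u; rewrite mem_filter !inE andbC.
have NE j : (N j)%:Z = (h_sum (class_sizes a) d)`_j.
  rewrite -h_sumE -(perm_big _ Gamma_greedy) /= big_map coef_sum Ncount.
  rewrite -sum1_count big_mkcond (big_morph Posz PoszD erefl).
  apply: eq_bigr => u _; rewrite coefXn sumn_exponents eq_sym.
  by case: eqP.
set M := (\max_(u <- enum_fset Gamma) mdeg u)%N.
have Nbig j : (M < j)%N -> N j = 0%N.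
  move=> Mj; rewrite Ncount; apply/eqP; rewrite -leqn0 leqNgt -has_count.
  apply/hasPn => u uG; rewrite ltn_eqF // (leq_ltn_trans _ Mj) //.
  exact: (leq_bigmax_seq u).
have NM : N M != 0%N.
  have GN0 : enum_fset Gamma != [::].
    apply: contraNneq gN0 => G0; rewrite -size_eq0 -(perm_size Gamma_greedy).
    by rewrite size_map G0.
  have [u uG uM] := bigmax_seq_attained (fun u : 'X_{1..d} => mdeg u) GN0.
  by rewrite Ncount -lt0n -has_count; apply/hasP; exists u; rewrite ?uM.
rewrite -[LHS]/(map Posz (mkseq N M.+1)).
have <- : Poly (map Posz (mkseq N M.+1)) = h_sum (class_sizes a) d.
  apply/polyP => j; rewrite -NE coef_Poly.
  case: (ltnP j M.+1) => jM; first by rewrite (nth_map 0%N) ?size_mkseq // nth_mkseq.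
  by rewrite nth_default ?size_map ?size_iota // Nbig.
rewrite (PolyK (c := 1)) //.
rewrite -nth_last size_map size_mkseq (nth_map 0%N) ?size_mkseq //.
by rewrite nth_mkseq.
Qed.
End Gamma.

(** * Hilbert series *)

(** Congruence modulo X^N stands in for identities of formal power series. *)
Definition agree_below (N : nat) (p q : {poly int}) : Prop :=
  forall i, (i < N)%N -> p`_i = q`_i.

Lemma agree_belowM N p p' q q' : agree_below N p p' -> agree_below N q q' ->
  agree_below N (p * q) (p' * q').
Proof.
move=> Hp Hq i iN; rewrite !coefM; apply: eq_bigr => j _.
by rewrite Hp ?Hq // (leq_ltn_trans _ iN) ?leq_subr // -ltnS.
Qed.

Lemma agree_belowX N p q e : agree_below N p q -> agree_below N (p ^+ e) (q ^+ e).
Proof.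
by move=> Hpq; elim: e => // e IH; rewrite !exprS; apply: agree_belowM.
Qed.

Lemma agree_below_sum (T : finType) (P : pred T) N (F G : T -> {poly int}) :
  (forall t, P t -> agree_below N (F t) (G t)) ->
  agree_below N (\sum_(t | P t) F t) (\sum_(t | P t) G t).
Proof.
by move=> FG i iN; rewrite !coef_sum; apply: eq_bigr => t Pt; apply: FG.
Qed.

(** 1 - X is invertible modulo X^N: coefficient i of (1 - X)p is p_i - p_(i-1), so agreement
    propagates upwards. *)
Lemma agree_below_cancel N e p q :
  agree_below N ((1 - 'X) ^+ e * p) ((1 - 'X) ^+ e * q) -> agree_below N p q.
Proof.
elim: e => [|e IH]; first by rewrite !mul1r.
rewrite exprS -!mulrA => H; apply: IH => i.
move: {p}(_ * p) {q}(_ * q) H => p q H; elim: i => [|i IHi] iN.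
  by have := H _ iN; rewrite !mulrBl !mul1r !coefB !coefXM !subr0.
have := H _ iN; rewrite !mulrBl !mul1r !coefB !coefXM /= (IHi (ltnW iN)).
exact: addIr.
Qed.

(** * Random vertex sets and independence of the classes *)

Section VertexSets.
Variable (T : finType).
Implicit Types (U V : {set T}).

Lemma sum_subsetU (R : nmodType) V1 V2 (f : {set T} -> R) : [disjoint V1 & V2] ->
  \sum_(U : {set T} | U \subset V1 :|: V2) f U =
  \sum_(U1 : {set T} | U1 \subset V1)
    \sum_(U2 : {set T} | U2 \subset V2) f (U1 :|: U2).
Proof.
move=> dis; rewrite pair_big /=.
rewrite (reindex_onto (fun u : {set T} * {set T} => u.1 :|: u.2)
  (fun U => (U :&: V1, U :&: V2))) /=; last by move=> U /setIidPl; rewrite setIUr.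
apply: eq_bigl => -[U1 U2] /=; apply/andP/andP => [[_ /eqP[<- <-]]|[s1 s2]].
  by rewrite !subsetIr.
rewrite setUSS //; split=> //; rewrite xpair_eqE !setIUl.
have /eqP -> : U2 :&: V1 == set0.
  by rewrite setI_eq0 disjoint_sym (disjointWr s2 dis).
have /eqP -> : U1 :&: V2 == set0 by rewrite setI_eq0 (disjointWl s1 dis).
by rewrite setU0 set0U (setIidPl s1) (setIidPl s2) !eqxx.
Qed.

(** For U inside V, this is the probability that a random subset of V equals U when each element is
    taken independently with probability X. *)
Definition bernoulli V U : {poly int} := 'X ^+ #|U| * (1 - 'X) ^+ #|V :\: U|.

Lemma bernoulli_sum V : \sum_(U : {set T} | U \subset V) bernoulli V U = 1.
Proof.
(* Expand the product of X + (1 - X) over V; the factors 0 + 1 outside V kill all sets not contained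
   in V. *)
pose F i : {poly int} := if i \in V then 'X else 0.
pose G i : {poly int} := if i \in V then 1 - 'X else 1.
have: \prod_i (F i + G i) = 1.
  by rewrite big1 // => i _; rewrite /F /G; case: ifP => _; rewrite ?add0r // subrKC.
rewrite bigA_distr /= => <-; rewrite big_mkcond; apply: eq_bigr => U _.
case: ifPn => [sUV|/subsetPn[v vU nvV]]; last first.
  by rewrite (bigD1 v) //= vU /F (negPf nvV) mul0r.
rewrite (bigID (mem U)) /= /bernoulli -!prodr_const; congr (_ * _).
  by apply: eq_bigr => i iU; rewrite iU /F (subsetP sUV).
rewrite big_mkcond [RHS]big_mkcond; apply: eq_bigr => i _.
by rewrite inE; case: (i \in U) => //=; rewrite /G; case: ifP.
Qed.

Lemma bernoulliU V1 V2 U1 U2 : [disjoint V1 & V2] ->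
  U1 \subset V1 -> U2 \subset V2 ->
  bernoulli (V1 :|: V2) (U1 :|: U2) = bernoulli V1 U1 * bernoulli V2 U2.
Proof.
move=> dis s1 s2; rewrite /bernoulli mulrACA -!exprD; congr (_ ^+ _ * _ ^+ _).
  rewrite cardsU -[RHS]subn0; congr (_ - _)%N; apply/eqP.
  by rewrite cards_eq0 setI_eq0 (disjointW s1 s2 dis).
have E : (V1 :|: V2) :\: (U1 :|: U2) = (V1 :\: U1) :|: (V2 :\: U2).
  apply/setP => v; rewrite !inE.
  case v1: (v \in V1).
    have v2 := disjointFr dis v1; rewrite v2 andbF !orbF.
    have /negbTE -> : v \notin U2 by apply: contraFN v2; apply: (subsetP s2).
    by rewrite !orbF.
  have /negbTE -> : v \notin U1 by apply: contraFN v1; apply: (subsetP s1).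
  by rewrite andbF.
rewrite E cardsU -[RHS]subn0; congr (_ - _)%N; apply/eqP.
by rewrite cards_eq0 setI_eq0 (disjointW (subsetDl _ _) (subsetDl _ _) dis).
Qed.

Variables (I : finType) (A : I -> {set T}).
Hypothesis A_disjoint : forall i j, i != j -> [disjoint A i & A j].

(** Condition on the trace U1 of U on the first class. U1 = A_i has weight X^(a_i) and leaves d
    unchanged; the other traces have total weight 1 - X^(a_i) and lower d by one. *)
Lemma at_least_bernoulli (r : seq I) d : uniq r ->
  \sum_(U : {set T} | (U \subset \bigcup_(i <- r) A i) &&
        (d <= count (fun i => ~~ (A i \subset U)) r)%N)
     bernoulli (\bigcup_(i <- r) A i) U = at_least [seq #|A i| | i <- r] d.
Proof.
elim: r d => [|i r IH] d.
  move=> _; rewrite big_nil /=; case: d => [|d] /=.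
    under eq_bigl => U do rewrite leq0n andbT.
    exact: bernoulli_sum.
  by rewrite big_pred0 // => U; rewrite andbF.
case/andP => ir Ur; rewrite big_cons.
set V := \bigcup_(j <- r) A j.
have dis : [disjoint A i & V].
  rewrite /V big_seq; elim/big_ind: _ => [|V1 V2 d1 d2|j jr].
  - by rewrite disjoint_sym disjoints_subset sub0set.
  - by rewrite -setI_eq0 setIUr setU_eq0 !setI_eq0 d1.
  by apply: A_disjoint; apply: contraNneq ir => ->.
case: d => [|d].
  under eq_bigl => U do rewrite leq0n andbT.
  by rewrite bernoulli_sum.
rewrite big_mkcondr sum_subsetU // /=.
(* Disjointness makes each event depend only on the trace of U on its own class. *)
have cE U1 U2 : U1 \subset A i -> U2 \subset V ->
    (~~ (A i \subset U1 :|: U2) +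
      count (fun j => ~~ (A j \subset U1 :|: U2)) r)%N =
    ((U1 != A i) + count (fun j => ~~ (A j \subset U2)) r)%N.
  move=> s1 s2; congr (nat_of_bool (~~ _) + _)%N.
    rewrite eqEsubset s1 /= -[RHS]andbT; apply/idP/andP => [s|[s _]].
      split=> //; apply/subsetP => v vA; have := subsetP s v vA.
      rewrite inE => /orP[//|/(subsetP s2)].
      by rewrite (disjointFr dis vA).
    by apply: subset_trans s (subsetUl _ _).
  apply: eq_in_count => j jr /=; congr (~~ _); apply/idP/idP => [s|s].
    apply/subsetP => v vA; have := subsetP s v vA.
    rewrite inE => /orP[/(subsetP s1) vi|//].
    have ji : j != i by apply: contraNneq ir => <-.
    by rewrite (disjointFr (A_disjoint ji) vA) in vi.
  by apply: subset_trans s (subsetUr _ _).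
have S e U1 : U1 \subset A i ->
   \sum_(U2 : {set T} | U2 \subset V)
     (if (e <= count (fun j => ~~ (A j \subset U2)) r)%N
      then bernoulli (A i :|: V) (U1 :|: U2) else 0) =
   bernoulli (A i) U1 * at_least [seq #|A j| | j <- r] e.
  move=> s1; rewrite -IH // -big_mkcondr mulr_sumr.
  by apply: eq_bigr => U2 /andP[s2 _]; rewrite bernoulliU.
have Ebern : bernoulli (A i) (A i) = 'X ^+ #|A i|.
  by rewrite /bernoulli setDv cards0 mulr1.
rewrite (bigD1 (A i)) //= addrC; congr (_ + _).
  transitivity (\sum_(U1 : {set T} | (U1 \subset A i) && (U1 != A i))
    bernoulli (A i) U1 * at_least [seq #|A j| | j <- r] d).
    apply: eq_bigr => U1 /andP[s1 n1]; rewrite -S //.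
    by apply: eq_bigr => U2 s2; rewrite cE // n1.
  rewrite -mulr_suml; congr (_ * _).
  rewrite -(bernoulli_sum (A i)) [in RHS](bigD1 (A i)) //= Ebern.
  by rewrite addrAC subrr add0r.
transitivity (bernoulli (A i) (A i) * at_least [seq #|A j| | j <- r] d.+1).
  by rewrite -S //; apply: eq_bigr => U2 s2; rewrite cE // eqxx.
by rewrite Ebern.
Qed.

End VertexSets.

(** * Counting monomials by support *)

Section Hilbert.
Variables (n : nat) (good : pred {set 'I_n}).
Implicit Types (U : {set 'I_n}).

Definition ffun_support N (c : {ffun 'I_n -> 'I_N.+1}) : {set 'I_n} :=
  [set i | c i != ord0].

(** In degree N no exponent exceeds N, so the exponent vectors can be taken in a finite type. *)
Definition good_exponents N : {set {ffun 'I_n -> 'I_N.+1}} :=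
  [set c | good (ffun_support c) & (\sum_i c i == N)%N].

(** The truncation of X/(1 - X), the series of positive powers of one variable. *)
Definition support_series N : {poly int} := \sum_(e < N.+1 | e != ord0) 'X^e.

Lemma coef_support_series N i : (support_series N)`_i = (0 < i <= N)%N%:R.
Proof.
rewrite coef_sum; case: (leqP i N) => iN; last first.
  rewrite andbF big1 // => e _; rewrite coefXn.
  by rewrite (gtn_eqF (leq_ltn_trans (_ : e <= N)%N iN)) // -ltnS.
rewrite andbT big_mkcond (bigD1 (Ordinal (iN : i < N.+1)%N)) //= big1.
  by rewrite -val_eqE /= coefXn eqxx addr0 -lt0n; case: ltnP.
move=> e; rewrite -val_eqE coefXn /= eq_sym => /negPf ->; by case: ifP.
Qed.

Lemma support_seriesE N : (1 - 'X) * support_series N = 'X - 'X^(N.+1).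
Proof.
have -> : support_series N = 'X * \sum_(e < N) 'X^e.
  rewrite /support_series big_mkcond big_ord_recl eqxx /= add0r mulr_sumr.
  by apply: eq_bigr => e _; rewrite -exprS.
rewrite mulrCA -[1 - 'X]opprB mulNr -subrX1 opprB mulrBr mulr1.
by rewrite -exprS.
Qed.

Lemma agree_support_series m N : (m <= N)%N ->
  agree_below m.+1 (support_series N) (support_series m).
Proof.
move=> mN i im; rewrite !coef_support_series; rewrite ltnS in im.
by rewrite im (leq_trans im mN).
Qed.

(** Group the exponent vectors by support: each variable in it contributes an independent positive
    exponent. *)
Lemma sum_ffun_support N :
  \sum_(c : {ffun 'I_n -> 'I_N.+1} | good (ffun_support c)) 'X^(\sum_i c i)%N =
  \sum_(U | good U) support_series N ^+ #|U|.
Proof.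
rewrite (partition_big (@ffun_support N) good) //=.
apply: eq_bigr => U gU; symmetry; rewrite -prodr_const.
transitivity (\prod_(v : 'I_n)
  \sum_(e < N.+1 | (e != ord0) == (v \in U)) ('X^e : {poly int})).
  rewrite big_mkcond; apply: eq_bigr => v _; case: (v \in U).
    by apply: eq_bigl => e; rewrite eqb_id.
  rewrite (eq_bigl (pred1 ord0)) ?big_pred1_eq ?expr0 // => e.
  by rewrite eqbF_neg negbK.
rewrite bigA_distr_big_dep; apply: eq_big => [c|c _]; last by rewrite prodrXr.
apply/familyP/andP => [H|[_ /eqP <-] v]; last by rewrite unfold_in /= inE.
suff E : ffun_support c = U by rewrite E gU eqxx.
by apply/setP => v; rewrite inE; have := H v; rewrite unfold_in => /eqP.
Qed.

(** Truncating at any N >= m leaves the coefficient in degree m unchanged, so one N serves all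
    degrees in the convolution below. *)
Lemma card_good_exponents N m : (m <= N)%N ->
  (#|good_exponents m|%:Z : int) = (\sum_(U | good U) support_series N ^+ #|U|)`_m.
Proof.
move=> mN.
rewrite (@agree_below_sum _ _ m.+1 _ (fun U => support_series m ^+ #|U|)) //;
  last first.
  by move=> U _; apply/agree_belowX/agree_support_series.
rewrite -sum_ffun_support coef_sum -sum1_card (big_morph Posz PoszD erefl).
rewrite /good_exponents big_mkcond [RHS]big_mkcond; apply: eq_bigr => c _.
by rewrite inE coefXn eq_sym; case: good => //=; case: eqP.
Qed.

Lemma hilbert_series d h : (d <= n)%N ->
  \sum_(U | good U) bernoulli [set: 'I_n] U = (1 - 'X) ^+ d * h ->
  forall m, \sum_(j < m.+1) ((1 - 'X) ^+ (n - d))`_j *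
    #|good_exponents (m - j)|%:Z = h`_m.
Proof.
move=> dn Eh m.
transitivity (((1 - 'X) ^+ (n - d) * \sum_(U | good U) support_series m ^+ #|U|)`_m).
  by rewrite coefM; apply: eq_bigr => j _; rewrite -card_good_exponents ?leq_subr.
(* Multiplying by (1 - X)^d gives total exponent n = |U| + |~U|. Each vertex of U absorbs one
   factor, since (1 - X) times the truncated series is X modulo X^(m+1). *)
apply: (@agree_below_cancel m.+1 d); last exact: leqnn.
rewrite -Eh mulrA -exprD subnKC // mulr_sumr; apply: agree_below_sum => U gU.
have nE : n = (#|U| + #|~: U|)%N by rewrite cardsC card_ord.
rewrite /bernoulli setTD [X in _ ^+ X * _]nE exprD mulrAC -exprMn support_seriesE.
apply: agree_belowM => //; apply: agree_belowX => i im.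
by rewrite coefB coefXn (ltn_eqF im) subr0.
Qed.

End Hilbert.

(** * Complete partite matroids *)

Lemma greedy_neq0 s d : all (leq 1) s -> (d <= size s)%N -> greedy s d != [::].
Proof.
elim: s d => [|a s IH] [|d] //= /andP[a_gt0 s_gt0] ds.
have := IH d s_gt0 ds; case: (greedy s d) => // bs g _.
by case: a a_gt0.
Qed.

(** * Monomial bases of the graded quotient *)

Section MonomialIdeal.
Variables (k : fieldType) (n : nat) (good : pred {set 'I_n}).
Variable I : {mpoly k[n]} -> Prop.
Hypothesis I_good : forall f,
  I f <-> (forall m, m \in msupp f -> ~~ good (msupport m)).

Definition monomial_of N (c : {ffun 'I_n -> 'I_N.+1}) : 'X_{1..n} :=
  [multinom val (c i) | i < n].

Lemma monomial_of_inj N : injective (@monomial_of N).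
Proof.
move=> c c' /mnmP E; apply/ffunP => i; apply: val_inj.
by have := E i; rewrite !mnmE.
Qed.

Lemma msupport_monomial_of N (c : {ffun 'I_n -> 'I_N.+1}) :
  msupport (monomial_of c) = ffun_support c.
Proof. by apply/setP => i; rewrite !inE mnmE. Qed.

Lemma mdeg_monomial_of N (c : {ffun 'I_n -> 'I_N.+1}) :
  mdeg (monomial_of c) = (\sum_i c i)%N.
Proof. by rewrite mdegE; apply: eq_bigr => i _; rewrite mnmE. Qed.

Lemma monomial_ofP N m : mdeg m = N -> good (msupport m) ->
  exists2 c, c \in good_exponents good N & monomial_of c = m.
Proof.
move=> dm gm; pose c := [ffun i => inord (m i) : 'I_N.+1].
have E : monomial_of c = m.
  apply/mnmP => i; rewrite mnmE ffunE /= inordK // ltnS -dm.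
  by rewrite mdegE (bigD1 i) //= leq_addr.
by exists c; rewrite // inE -msupport_monomial_of -mdeg_monomial_of E gm dm /=.
Qed.

(** The monomials with good support form a basis: removing the good terms of [f] leaves an element
    of I, and no nonzero combination of good monomials lies in I. *)
Lemma monomial_ideal_hilbert :
  hilbert_function I (fun m => #|good_exponents good m|).
Proof.
move=> N; pose e (i : 'I_#|good_exponents good N|) := monomial_of (enum_val i).
have e_inj : injective e by move=> i j /monomial_of_inj/enum_val_inj.
have e_good i : good (msupport (e i)) /\ mdeg (e i) = N.
  have := enum_valP i; rewrite inE -msupport_monomial_of -mdeg_monomial_of.
  by case/andP => -> /eqP.
have coefE (c : _ -> k) m :
    (\sum_i c i *: 'X_[e i])@_m = \sum_(i | e i == m) c i.
  rewrite raddf_sum [RHS]big_mkcond; apply: eq_bigr => i _ /=.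
  by rewrite mcoeffZ mcoeffX; case: eqP; rewrite ?mulr1 ?mulr0.
have coef_e (c : _ -> k) i : (\sum_i c i *: 'X_[e i])@_(e i) = c i.
  by rewrite coefE (eq_bigl (pred1 i)) ?big_pred1_eq // => j; rewrite /= inj_eq.
exists (fun i => 'X_[e i]); split=> [i|f fN|c /I_good Hc i].
- by rewrite dhomogX /= (e_good i).2.
- exists (fun i => f@_(e i)); apply/I_good => m.
  rewrite mcoeff_msupp; apply: contraNN => gm; rewrite mcoeffB subr_eq0.
  case: (eqVneq (mdeg m) N) => dm; last first.
    rewrite (dhomog_nemf_coeff fN) // coefE big_pred0 // => i.
    by apply: contraNF dm => /eqP <-; rewrite (e_good i).2.
  have [c cG <-] := monomial_ofP dm gm.
  rewrite -(enum_rankK_in cG cG) -/(e _) coef_e.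
  by [].
apply/eqP/negPn/negP => ci.
have := Hc (e i); rewrite mcoeff_msupp coef_e (e_good i).1.
by move/(_ ci).
Qed.

End MonomialIdeal.

Section CompletePartite.
Variables (n d p : nat) (Delta : {set {set 'I_n}}) (A : 'I_p -> {set 'I_n}).
Hypothesis hDelta : complete_partite_matroid Delta d A.
Implicit Types (F G U : {set 'I_n}).

Let Delta_matroid : matroid Delta.
Proof. by case: hDelta. Qed.

Let A_classes : parallel_classes Delta A.
Proof. by case: hDelta. Qed.

Lemma rankE : (\max_(F in Delta) #|F|)%N = d.
Proof. by case: hDelta => _ _ /eqP; rewrite /dimension (inj_eq (addIr _)) => /eqP[]. Qed.

Lemma face_card F : F \in Delta -> (#|F| <= d)%N.
Proof. by rewrite -rankE => FD; apply: leq_bigmax_cond. Qed.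

Lemma facet_of_card F : F \in Delta -> #|F| = d -> F \in facets Delta.
Proof.
move=> FD Fd; rewrite inE FD; apply/forall_inP => G GD; apply/implyP => sFG.
by rewrite eqEcard sFG Fd face_card.
Qed.

Lemma facet_exists : exists F, F \in facets Delta.
Proof.
have D0 : (0 < #|Delta|)%N by apply/card_gt0P; exists set0; case: Delta_matroid => -[].
have [F FD EF] := eq_bigmax_cond (fun F : {set 'I_n} => #|F|) D0.
by exists F; apply: facet_of_card => //; rewrite -rankE.
Qed.

Lemma facet_face F : F \in facets Delta -> F \in Delta.
Proof. by rewrite inE => /andP[]. Qed.

(** A smaller facet could be enlarged by exchange with a face of maximal size. *)
Lemma facet_card F : F \in facets Delta -> #|F| = d.
Proof.
move=> Ff; have FD := facet_face Ff; apply/eqP.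
rewrite eqn_leq face_card //= leqNgt; apply/negP => ltF.
have D0 : (0 < #|Delta|)%N by apply/card_gt0P; exists F.
have [G GD EG] := eq_bigmax_cond (fun F : {set 'I_n} => #|F|) D0.
rewrite rankE in EG; rewrite EG in ltF.
case: Delta_matroid => _ /(_ F G FD GD ltF)[i]; rewrite inE => /andP[iF _] iFD.
move: Ff; rewrite inE => /andP[_ /forall_inP/(_ _ iFD)].
by rewrite subsetUr /= => /eqP E; rewrite E setU11 in iF.
Qed.

Lemma classes_disjoint i j : i != j -> [disjoint A i & A j].
Proof. by case: A_classes => _ + _ _; apply. Qed.

Lemma class_unique i j v : v \in A i -> v \in A j -> i = j.
Proof.
move=> vi vj; apply/eqP/negPn/negP => /classes_disjoint/disjointFr/(_ vi).
by rewrite vj.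
Qed.

(** Two distinct vertices of a face span an edge, and no edge lies inside a class. *)
Lemma face_class F i v w : F \in Delta -> v \in F -> w \in F ->
  v \in A i -> w \in A i -> v = w.
Proof.
move=> FD vF wF vi wi; apply/eqP/negPn/negP => vw.
case: A_classes => _ _ _ /(_ i i v w vi wi); rewrite eqxx /skeleton_edge vw /=.
have sub : [set v; w] \subset F by apply/subsetP => u; rewrite !inE => /orP[] /eqP ->.
by case: Delta_matroid => -[_ /(_ [set v; w] F FD sub)] ->.
Qed.

Definition many_classes_left U : bool := (d <= #|[set i | ~~ (A i \subset U)]|)%N.

(** Choosing a vertex outside U in each of d incomplete classes gives a facet by complete
    partiteness. Conversely, the d vertices of a facet avoiding U lie in distinct classes, all
    incomplete. *)
Lemma many_classes_leftP U :
  reflect (exists2 F, F \in facets Delta & [disjoint F & U]) (many_classes_left U).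
Proof.
apply: (iffP idP) => [gU|[F Ff FU]].
  have [I sI dI] : exists2 I : {set 'I_p},
      I \subset [set i | ~~ (A i \subset U)] & #|I| = d.
    have /card_gt0P[I] : (0 < #|[set I : {set 'I_p} |
        I \subset [set i | ~~ (A i \subset U)] & #|I| == d]|)%N.
      by rewrite cards_draws bin_gt0.
    by rewrite inE => /andP[sI /eqP dI]; exists I.
  have /fin_all_exists[v Hv] i : exists v, v \in A i /\ (i \in I -> v \notin U).
    case iI: (i \in I); last first.
      by case: A_classes => /(_ i)/set0Pn[v vi] _ _ _; exists v.
    have := subsetP sI i iI; rewrite inE => /subsetPn[v vi vU].
    by exists v.
  exists (v @: I); last first.
    by apply/pred0Pn => -[u /= /andP[/imsetP[i iI ->]]]; apply/negP/(Hv i).2.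
  apply: facet_of_card.
    by case: hDelta => _ _ _ _; apply=> // i _; apply: (Hv i).1.
  rewrite card_in_imset // => i j _ _ E.
  by apply: (@class_unique _ _ (v i)); [exact: (Hv i).1 | rewrite E; exact: (Hv j).1].
have /fin_all_exists[cl Hcl] (v : 'I_n) : exists i, v \in A i.
  case: A_classes => _ _ /setP/(_ v) + _.
  by rewrite inE => /bigcupP[i _ vi]; exists i.
rewrite /many_classes_left -(facet_card Ff) -(@card_in_imset _ _ cl); last first.
  move=> v w vF wF E; apply: (face_class (facet_face Ff) vF wF (Hcl v)).
  by rewrite E.
apply: subset_leq_card; apply/subsetP => _ /imsetP[v vF ->]; rewrite inE.
by apply/subsetPn; exists v; rewrite ?(disjointFr FU).
Qed.

Lemma rank_le_n : (d <= n)%N.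
Proof.
by have [F /facet_card <-] := facet_exists; rewrite -[leqRHS]card_ord max_card.
Qed.

Lemma rank_le_p : (d <= p)%N.
Proof.
have [F Ff] := facet_exists.
have /many_classes_leftP : exists2 F, F \in facets Delta & [disjoint F & set0].
  by exists F => //; rewrite disjoint_sym disjoints_subset sub0set.
by move/leq_trans; apply; rewrite -[leqRHS]card_ord max_card.
Qed.

Lemma class_gt0 i : (0 < #|A i|)%N.
Proof. by rewrite card_gt0; case: A_classes. Qed.

Lemma rank0 : d = 0%N -> p = 0%N.
Proof.
move=> d0; apply/eqP; rewrite -leqn0 leqNgt; apply/negP => p_gt0.
have /card_gt0P[v _] := class_gt0 (Ordinal p_gt0).
have /face_card : [set v] \in Delta by case: hDelta.
by rewrite cards1 d0.
Qed.

Lemma many_classes_left_bernoulli :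
  \sum_(U | many_classes_left U) bernoulli [set: 'I_n] U =
  at_least (class_sizes (fun i => #|A i|)) d.
Proof.
have AT : \bigcup_(i <- enum 'I_p) A i = [set: 'I_n].
  by rewrite big_enum; case: A_classes.
rewrite -(at_least_bernoulli classes_disjoint _ (enum_uniq 'I_p)) AT.
apply: eq_bigl => U; rewrite subsetT /many_classes_left -size_filter.
by rewrite cardsE cardE enumT.
Qed.

Section CoverIdeal.
Variable k : fieldType.

Lemma cover_idealP (f : {mpoly k[n]}) : cover_ideal k Delta f <->
  (forall m, m \in msupp f -> ~~ many_classes_left (msupport m)).
Proof.
split=> [Jf m mf|Hf F Ff].
  apply/many_classes_leftP => -[F Ff]; apply/negP.
  by move/variable_idealP: (Jf F Ff); apply.
apply/variable_idealP => m /Hf; apply: contraNN => dis.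
by apply/many_classes_leftP; exists F.
Qed.

(** The product of the variables outside P is not in P, hence not in the cover ideal. So some facet
    avoids its support, and all variables of that facet lie in P. *)
Lemma prime_over_cover_ideal (P : {mpoly k[n]} -> Prop) :
  is_prime_ideal P -> ideal_le (cover_ideal k Delta) P ->
  exists2 F, F \in facets Delta & ideal_le (variable_ideal F) P.
Proof.
case=> PI P1 PM JP.
pose U := [set i | if excluded_middle_informative (P 'X_i) then false else true].
have UP i : i \notin U -> P 'X_i.
  by rewrite inE; case: excluded_middle_informative.
have nPU i : i \in U -> ~ P 'X_i.
  by rewrite inE; case: excluded_middle_informative.
pose m : 'X_{1..n} := [multinom (i \in U : nat) | i < n].
have mU : msupport m = U by apply/setP => i; rewrite inE mnmE; case: (i \in U).
have nPm : ~ P 'X_[m].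
  rewrite mpolyXE_id; apply: (big_ind (fun f => ~ P f)) => // [f g nf ng /PM[]//|i _].
  rewrite mnmE; case iU: (i \in U); last by rewrite expr0.
  exact: nPU iU.
have /many_classes_leftP[F Ff dis] : many_classes_left (msupport m).
  apply/negPn/negP => bad; apply: nPm; apply/JP/cover_idealP => m'.
  by rewrite msuppX mem_seq1 => /eqP ->.
exists F => //; apply: variable_ideal_sub => // i iF; apply: UP.
by rewrite -mU (disjointFr dis).
Qed.

Lemma facetC_card F : F \in facets Delta -> #|~: F| = (n - d)%N.
Proof. by move=> Ff; rewrite cardsCs setCK card_ord facet_card. Qed.

Lemma cover_ideal_krull_dim : krull_dim_quotient (cover_ideal k Delta) (n - d).
Proof.
split=> [|r P [Pprime Plt]].
  have [F Ff] := facet_exists; have [P [Pprime Plt]] := prime_chain_variables k F.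
  rewrite (facetC_card Ff) in Pprime Plt.
  exists P; split=> // i iD; have [? le_P] := Pprime i iD; split=> // f Jf.
  exact/le_P/Jf.
have [P0 JP0] := Pprime 0%N isT.
have [F Ff FP0] := prime_over_cover_ideal P0 JP0.
(* The whole chain lies above P_F because its first member does. *)
rewrite -(facetC_card Ff); apply: (@prime_chain_bound k n F r P); split=> // i ir.
split; first by case: (Pprime i ir).
elim: i ir => // i IH ir f Ff'; have [le_P _] := Plt i ir.
exact/le_P/IH/Ff'/ltnW.
Qed.

End CoverIdeal.
End CompletePartite.

Theorem theorem3p5 (k : fieldType) (n d p : nat) (Delta : {set {set 'I_n}})
    (A : 'I_p -> {set 'I_n}) (Gamma : {fset 'X_{1..d}})
    (hDelta : complete_partite_matroid Delta d A)
    (hGamma_ideal : order_ideal Gamma)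
    (hGamma_pure : pure Gamma)
    (hGamma_max : forall u : 'X_{1..d},
       maximal_monomial Gamma u <-> block_monomial (fun i => #|A i|) u) :
  h_vector (cover_ideal k Delta) (map Posz (f_vector Gamma)).
Proof.
exists (h_sum (class_sizes (fun i => #|A i|)) d); last first.
  apply: (f_vectorE (class_gt0 hDelta) (rank0 hDelta) hGamma_ideal hGamma_max).
  apply: greedy_neq0; last by rewrite size_map size_enum_ord (rank_le_p hDelta).
  by apply/allP => _ /mapP[i _ ->]; apply: class_gt0 hDelta i.
exists (n - d)%N, (fun m => #|good_exponents (many_classes_left d A) m|); split.
- exact: cover_ideal_krull_dim hDelta k.
- exact/monomial_ideal_hilbert/cover_idealP.
(* The factor (1 - X)^d split off by [at_leastE] lowers the pole order from n to the Krull dimension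
   n - d. *)
apply: hilbert_series (rank_le_n hDelta) _.
by rewrite (many_classes_left_bernoulli hDelta) at_leastE.
Qed.
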